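(* On the pseudosphere $\mathbb{S}^{3,3}=\{x\in\mathbb{R}^7: x_1^2+x_2^2+x_3^2-x_4^2-x_5^2-x_6^2-x_7^2=-1\}$ there exist integrable almost para-complex structures (that is, para-complex structures).
   Context: $\mathbb{S}^{3,3}$ is regarded as a smooth $6$-dimensional submanifold of $\mathbb{R}^7$. An almost para-complex structure on a $2n$-dimensional manifold $M$ is a field $P$ of endomorphisms of $TM$ with $P^2=\mathrm{Id}$ such that the eigen-distributions $T^{\pm}=\ker(\mathrm{Id}\mp P)$ have equal rank. It is integrable (a para-complex structure) if both $T^+$ and $T^-$ are involutive. No compatibility with the pseudo-Riemannian metric is claimed. *)

(* Defs.v *)
From HB Require Import structures.
From mathcomp Require Import all_boot all_order all_algebra.
From mathcomp Require Import all_classical all_reals all_analysis.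
From mathcomp Require Import ring.

Set Implicit Arguments.
Unset Strict Implicit.
Unset Printing Implicit Defensive.

Import Order.TTheory GRing.Theory Num.Theory.
Import numFieldNormedType.Exports.

Local Open Scope classical_set_scope.
Local Open Scope ring_scope.

Section Smoothness.
Context {R : realType} {n m : nat}.
Notation V := 'rV[R]_n.
Notation W := 'rV[R]_m.

(* C^k and C^oo maps; meaningful when [U] is open. *)
Fixpoint Ck_on (k : nat) (U : set V) (f : V -> W) : Prop :=
  match k with
  | 0 => forall x, U x -> {for x, continuous f}
  | k'.+1 => (forall x, U x -> differentiable f x) /\
             (forall v, Ck_on k' U ('D_v f))
  end.

Definition Coo_on (U : set V) (f : V -> W) : Prop := forall k, Ck_on k U f.

(* Smoothness on an arbitrary subset [A]: near every point of [A], [f]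
   coincides on [A] with a map that is smooth on an open set of R^n.  Values of
   [f] outside [A] are irrelevant. *)
Definition smooth_on (A : set V) (f : V -> W) : Prop :=
  forall p, A p -> exists (O : set V) (g : V -> W),
    [/\ open O, O p, Coo_on O g & forall x, A x -> O x -> f x = g x].

End Smoothness.

(* In this section [M] is a submanifold of R^n and [T x] is the tangent space
   of [M] at [x], as a linear subspace of R^n; [T x] is only used for [x] in
   [M]. *)
Section ParaComplex.
Context {R : realType} {n : nat}.
Notation V := 'rV[R]_n.
Variables (M : set V) (T : V -> {vspace V}).

Definition distribution := V -> {vspace V}.

(* Smooth sections of [D] over the relatively open part [M `&` U] of [M]. *)
Definition smooth_section (D : distribution) (U : set V) (X : V -> V) : Prop :=
  smooth_on (M `&` U) X /\ (forall x, M x -> U x -> X x \in D x).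

Definition endo_field := forall x : V, 'End(subvs_of (T x)).

Definition endo_apply (P : endo_field) (X : V -> V) : V -> V :=
  fun x => vsval (P x (vsproj (T x) (X x))).

Definition smooth_endo_field (P : endo_field) : Prop :=
  forall (U : set V) (X : V -> V), open U ->
    smooth_section T U X -> smooth_section T U (endo_apply P X).

(* T^+ = ker (Id - P) and T^- = ker (Id + P), seen as subspaces of R^n through
   the inclusion of [T x]. *)
Definition eigen_plus (P : endo_field) : distribution :=
  fun x => (linfun (@vsval _ _ (T x)) @: lker (\1%VF - P x)%R)%VS.

Definition eigen_minus (P : endo_field) : distribution :=
  fun x => (linfun (@vsval _ _ (T x)) @: lker (\1%VF + P x)%R)%VS.

Definition lie_bracket (X Y : V -> V) : V -> V :=
  fun x => 'D_(X x) Y x - 'D_(Y x) X x.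

(* Sections of [D] over open parts of [M] are represented by smooth extensions
   to open sets [U] of R^n; such extensions exist locally, and at points of [M]
   the bracket of two fields tangent to [M] does not depend on them. *)
Definition involutive_dist (D : distribution) : Prop :=
  forall (U : set V) (X Y : V -> V), open U ->
    Coo_on U X -> Coo_on U Y ->
    (forall x, M x -> U x -> X x \in D x) ->
    (forall x, M x -> U x -> Y x \in D x) ->
    forall x, M x -> U x -> lie_bracket X Y x \in D x.

Definition almost_para_complex (P : endo_field) : Prop :=
  [/\ smooth_endo_field P,
      forall x, M x -> (P x \o P x)%VF = \1%VF &
      forall x, M x -> \dim (eigen_plus P x) = \dim (eigen_minus P x)].

Definition integrable_para (P : endo_field) : Prop :=
  involutive_dist (eigen_plus P) /\ involutive_dist (eigen_minus P).

Definition para_complex (P : endo_field) : Prop :=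
  almost_para_complex P /\ integrable_para P.

End ParaComplex.

Section Pseudosphere.
Context {R : realType}.

Definition qform33 (x : 'rV[R]_7) : R^o :=
  \sum_(i < 7 | (i < 3)%N) x 0 i ^+ 2 - \sum_(i < 7 | (3 <= i)%N) x 0 i ^+ 2.

Definition S33 : set 'rV[R]_7 := [set x | qform33 x = -1].

(* The tangent space of the regular level set [S33] at [x] is the kernel of the
   differential of its defining function; see [mem_TS33], [dim_TS33] and
   [TS33_velocity] below. *)
Definition TS33 (x : 'rV[R]_7) : {vspace 'rV[R]_7} :=
  lker (linfun ('d qform33 x)).

Definition bform33 (x y : 'rV[R]_7) : R :=
  \sum_(i < 7 | (i < 3)%N) x 0 i * y 0 i
  - \sum_(i < 7 | (3 <= i)%N) x 0 i * y 0 i.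

Lemma is_diff_qform33 (x : 'rV[R]_7) :
  is_diff x qform33 (fun v => 2 * bform33 x v : R^o).
Proof.
have is_diff_bsum (Q : pred 'I_7) :
    is_diff x (fun y : 'rV[R]_7 => \sum_(i < 7 | Q i) y 0 i ^+ 2 : R^o)
              (fun v => 2 * \sum_(i < 7 | Q i) x 0 i * v 0 i : R^o).
  have -> : (fun y : 'rV[R]_7 => \sum_(i < 7 | Q i) y 0 i ^+ 2 : R^o) =
            \sum_(i < 7 | Q i) ((fun y : 'rV[R]_7 => y 0 i : R^o) ^+ 2).
    by apply/funext => y; rewrite fct_sumE.
  have -> : (fun v : 'rV[R]_7 => 2 * \sum_(i < 7 | Q i) x 0 i * v 0 i : R^o) =
            \sum_(i < 7 | Q i)
              ((2 * x 0 i ^+ 1) *: (fun v : 'rV[R]_7 => v 0 i : R^o)).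
    apply/funext => v; rewrite fct_sumE mulr_sumr; apply: eq_bigr => i _.
    by rewrite expr1 mulrA.
  elim/big_rec2 : _ => [|i f g Qi dgf]; first exact: is_diff_cst.
  apply: is_diffD => //; apply: is_diffX.
  have lc : linear (fun y : 'rV[R]_7 => y 0 i : R^o).
    by move=> a u w; rewrite !mxE.
  have cd : differentiable (fun y : 'rV[R]_7 => y 0 i : R^o) x.
    exact: differentiable_coord.
  apply: DiffDef => //.
  pose f0 : {linear 'rV[R]_7 -> R^o} := HB.pack (fun y : 'rV[R]_7 => y 0 i : R^o)
    (GRing.isLinear.Build _ _ _ _ _ lc).
  by rewrite (_ : (fun y => _) = f0 :> (_ -> _)) // diff_lin //;
    exact: coord_continuous.
have := is_diffB (is_diff_bsum (fun i : 'I_7 => (i < 3)%N))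
                 (is_diff_bsum (fun i : 'I_7 => (3 <= i)%N)).
rewrite (_ : _ - _ = qform33); last by [].
by move=> h; apply: is_diff_eq; apply/funext => v; rewrite /bform33 mulrBr.
Qed.

Lemma mem_TS33 (x v : 'rV[R]_7) : (v \in TS33 x) = (bform33 x v == 0).
Proof.
have h := is_diff_qform33 x.
by rewrite memv_ker lfunE /= diff_val mulf_eq0 pnatr_eq0.
Qed.

Lemma dim_TS33 (x : 'rV[R]_7) : S33 x -> \dim (TS33 x) = 6.
Proof.
move=> Sx; have h := is_diff_qform33 x.
have := limg_ker_dim (linfun ('d (qform33) x)) fullv.
rewrite capfv dimvf /dim /= => e.
suff e1 : \dim (limg (linfun ('d (qform33) x))) = 1%N.
  by move: e; rewrite e1 /= mul1n addn1 => -[].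
apply/eqP; rewrite eqn_leq; apply/andP; split.
  by apply: leq_trans (dimvS (subvf _)) _; rewrite dimvf.
rewrite lt0n dimv_eq0; apply/negP => /eqP e0.
have : linfun ('d (qform33) x) x \in (0 : {vspace R^o})%VS.
  by rewrite -e0 memv_img // memvf.
rewrite memv0 lfunE /= diff_val mulf_eq0 pnatr_eq0 /= => /eqP b0.
have : qform33 x = 0.
  by rewrite -[RHS]b0; congr (_ - _); apply: eq_bigr => i _; rewrite expr2.
by rewrite Sx => /eqP; rewrite oppr_eq0 oner_eq0.
Qed.

Lemma TS33_velocity (x v : 'rV[R]_7) : S33 x ->
  v \in TS33 x <->
  exists c : R -> 'rV[R]_7,
    [/\ \forall t \near (0 : R), S33 (c t), c 0 = x &
        is_derive (0 : R) (1 : R) c v].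
Proof.
move=> Sx; split=> [|[c [Sc c0 [dc dcv]]]]; last first.
  have cd : differentiable c 0 by exact/derivable1_diffP.
  have qd := is_diff_qform33 (c 0).
  have : 'D_1 (qform33 \o c) (0 : R) = 'D_1 (cst (-1 : R^o)) (0 : R).
    by apply: near_eq_derive; near=> t; rewrite /=; near: t.
  rewrite derive_cst deriveE; last exact: differentiable_comp.
  rewrite diff_comp //= diff_val c0 mem_TS33.
  have -> : 'd c 0 1 = v by rewrite -deriveE.
  by move=> /eqP; rewrite mulf_eq0 pnatr_eq0.
rewrite mem_TS33 => /eqP bxv.
have is_deriveZl (f : R -> R) (a : R) (u : 'rV[R]_7) :
    is_derive (0 : R) (1 : R) f a ->
    is_derive (0 : R) (1 : R) (fun t => f t *: u) (a *: u).
  move=> [df <-]; have fd : differentiable f 0 by exact/derivable1_diffP.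
  have sd := is_diff_scalel (f 0) u.
  have gd : differentiable (( *:%R ^~ u) \o f) 0 by exact: differentiable_comp.
  apply: DeriveDef; first exact/derivable1_diffP.
  rewrite (_ : (fun t => f t *: u) = ( *:%R ^~ u) \o f) //.
  by rewrite deriveE // diff_comp //= diff_val deriveE.
pose k := qform33 v : R.
pose r (t : R) : R := 1 - k * t ^+ 2.
have r0 : r 0 = 1 by rewrite /r expr0n mulr0 subr0.
have dr : is_derive (0 : R) (1 : R) r 0.
  rewrite (_ : r = cst 1 - k \*: (id ^+ 2)) //.
  have h := is_deriveX 2 (is_derive_id (0 : R) (1 : R)).
  have := is_deriveB (is_derive_cst (1 : R) (0 : R) (1 : R)) (is_deriveZ k h).
  by rewrite /= expr1 mulr0 scale0r scaler0 subr0.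
pose s (t : R) : R := (Num.sqrt (r t))^-1.
have s0 : s 0 = 1 by rewrite /s r0 sqrtr1 invr1.
have ds : is_derive (0 : R) (1 : R) s 0.
  have h : is_derive (r 0) 1 Num.sqrt (2 * Num.sqrt (r 0))^-1.
    by apply: is_derive1_sqrt; rewrite r0.
  have h1 := is_derive1_comp h dr.
  have nz : (Num.sqrt \o r) 0 != 0 by rewrite /= r0 sqrtr1 oner_eq0.
  have := is_deriveV nz h1.
  by rewrite mulr0 scaler0.
have dst : is_derive (0 : R) (1 : R) (s * id) 1.
  by apply: is_derive_eq; rewrite s0 scale1r scaler0 addr0.
exists (fun t => s t *: x + (s * id) t *: v); split.
- have rpos : \forall t \near (0 : R), 0 < r t.
    have rc : {for 0, continuous r}.
      by apply: differentiable_continuous; apply/derivable1_diffP; case: dr.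
    by apply: (cvgr_gt _ rc); rewrite r0.
  near=> t; rewrite /S33 /=.
  have rt : 0 < r t by near: t.
  have -> : qform33 (s t *: x + (s * id) t *: v) =
      s t ^+ 2 * (qform33 x + 2 * t * bform33 x v + t ^+ 2 * k) :> R.
    have E (Q : pred 'I_7) :
        \sum_(i < 7 | Q i) (s t *: x + (s * id) t *: v) 0 i ^+ 2 =
        s t ^+ 2 * (\sum_(i < 7 | Q i) x 0 i ^+ 2
          + 2 * t * (\sum_(i < 7 | Q i) x 0 i * v 0 i)
          + t ^+ 2 * (\sum_(i < 7 | Q i) v 0 i ^+ 2)).
      rewrite !mulr_sumr -!big_split /= mulr_sumr; apply: eq_bigr => i _.
      by rewrite !mxE (_ : (s * id) t = s t * t) //; ring.
    by rewrite /k /qform33 /bform33 !E; ring.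
  rewrite Sx bxv mulr0 addr0 /s exprVn sqr_sqrtr ?ltW //.
  rewrite (_ : -1 + _ = - r t); last by rewrite /r opprB addrC mulrC.
  by rewrite mulrN mulVf ?gt_eqF.
- by rewrite /= s0 scale1r [(s * id) 0]mulr0 scale0r addr0.
- have := is_deriveD (is_deriveZl _ _ x ds) (is_deriveZl _ _ v dst).
  by rewrite scale0r add0r scale1r.
Unshelve. all: by end_near. Qed.

End Pseudosphere.

(* Main.v *)
Require Import Defs.
From HB Require Import structures.
From mathcomp Require Import all_boot all_order all_algebra.
From mathcomp Require Import all_classical all_reals all_analysis.
From mathcomp Require Import ring lra.

(** Write a point of R^7 as x = (u, y) with u in R^3 and y in R^4.  The equation
    of the pseudosphere reads |y|^2 = 1 + |u|^2, so y never vanishes on it and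
    (u, y) |-> (u, y / |y|) identifies it with R^3 x S^3.  A product of two
    manifolds of equal dimension carries the para-complex structure that is +1 on
    the first factor and -1 on the second; the proof transports this one to R^7.

    At (u, y) the leaf through R^3 keeps the direction of y, hence
    T^+ = {(a, c y) : c |y|^2 = <u, a>}, and the leaf through S^3 keeps u, hence
    T^- = {(0, b) : <y, b> = 0}.  The involution with these eigenspaces is
    (a, b) |-> (a, 2 c y - b) with c = <u, a> / (1 + |u|^2), see [refl33]; the
    denominator is written 1 + |u|^2 because this is positive on all of R^7,
    which makes the formula smooth on the whole ambient space.

    Involutivity uses Frobenius' criterion in the form of
    [involutive_of_forms]: T^+ and T^- are cut out of the tangent space by
    1-forms with linear coefficients, y_i dy_j - y_j dy_i for T^+ and y_j du_i
    for T^-, whose exterior derivatives vanish on the distribution.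
    The equality of ranks comes from T^+ being the graph of a linear map on R^3,
    hence of rank 3, and from the ranks of the two eigenspaces adding up to 6
    ([dim_eigen_involution]).  Smoothness is the stability of scalar C^k functions
    under sums, products and inverses, transferred to vector-valued maps by
    [Ck_on_coord]. *)

Set Implicit Arguments.
Unset Strict Implicit.
Unset Printing Implicit Defensive.

Import Order.TTheory GRing.Theory Num.Theory.
Import numFieldNormedType.Exports.

Local Open Scope classical_set_scope.
Local Open Scope ring_scope.

(** * Scalar functions of class C^k *)

(** The first-order expansion of f at x is also one of g, and a continuous linear
    map with this property can only be the differential of g. *)
Lemma near_eq_differentiable (R : numFieldType) (V W : normedModType R)
    (f g : V -> W) (x : V) :
  (\near x, f x = g x) -> differentiable f x -> differentiable g x.
Proof.
move=> fg df; have /diff_locallyP[dc /eqaddoP fo] := df.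
have go : g \o shift x = cst (g x) + 'd f x +o_ 0 id.
  apply/eqaddoP => e e0; have fx := fo _ e0.
  have sfg : \forall h \near (0 : V), f (h + x) = g (h + x).
    by move: fg; rewrite (near_shift 0) subr0.
  near=> h; rewrite /= !fctE /= -(near sfg h) // -(nbhs_singleton fg).
  by near: h; exact: fx.
apply/diff_locallyP.
by rewrite (diff_unique dc go); split.
Unshelve. all: by end_near. Qed.

Section ScalarSmoothness.
Context {R : realType} {n : nat}.
Notation V := 'rV[R]_n.

(** The recursion of [Ck_on] for functions with values in R itself, where
    products and inverses make sense. *)
Fixpoint Ck_fun (k : nat) (U : set V) (f : V -> R^o) : Prop :=
  match k with
  | 0 => forall x, U x -> {for x, continuous f}
  | k'.+1 => (forall x, U x -> differentiable f x) /\
             (forall v, Ck_fun k' U ('D_v f))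
  end.

Variables (U : set V) (oU : open U).

Let near_in (f g : V -> R^o) x :
  (forall y, U y -> f y = g y) -> U x -> \forall y \near x, f y = g y.
Proof.
move=> fg Ux; have : nbhs x U by exact: open_nbhs_nbhs.
exact: filterS.
Qed.

(** The Leibniz rule and its analogues give the derivative of a combination only
    at points of U, where the functions are known to be differentiable; since U is
    open, equality on U is enough to transfer the class. *)
Lemma eq_Ck_fun k (f g : V -> R^o) :
  (forall x, U x -> f x = g x) -> Ck_fun k U f -> Ck_fun k U g.
Proof.
elim: k f g => [|k IH] f g fg /=.
  move=> fc x Ux; rewrite /prop_for /continuous_at -(fg _ Ux).
  apply: cvg_trans (fc x Ux).
  exact: (@near_eq_cvg _ _ (nbhs x)) (near_in fg Ux).
move=> [df Df]; split=> [x Ux|v].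
  exact: near_eq_differentiable (near_in fg Ux) (df x Ux).
by apply: IH (Df v) => x Ux; exact: near_eq_derive (near_in fg Ux).
Qed.

Lemma Ck_funW k f : Ck_fun k.+1 U f -> Ck_fun k U f.
Proof.
elim: k f => [|k IH] f /= [df Df].
  by move=> x Ux; exact: differentiable_continuous (df x Ux).
by split=> // v; exact: IH (Df v).
Qed.

Lemma Ck_fun_cst k a : Ck_fun k U (cst a).
Proof.
elim: k a => [|k IH] a /=; first by move=> x _; exact: cst_continuous.
split=> [x _|v]; first exact: differentiable_cst.
by apply: eq_Ck_fun (IH 0) => x _; rewrite derive_cst.
Qed.

Lemma Ck_funD k f g : Ck_fun k U f -> Ck_fun k U g -> Ck_fun k U (f + g).
Proof.
elim: k f g => [|k IH] f g /=.
  by move=> cf cg x Ux; apply: continuousD; [exact: cf|exact: cg].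
move=> [df Df] [dg Dg]; split=> [x Ux|v].
  by apply: differentiableD; [exact: df|exact: dg].
apply: eq_Ck_fun (IH _ _ (Df v) (Dg v)) => x Ux.
by rewrite deriveD //; apply: diff_derivable; [exact: df|exact: dg].
Qed.

Lemma Ck_funM k f g : Ck_fun k U f -> Ck_fun k U g -> Ck_fun k U (f * g).
Proof.
elim: k f g => [|k IH] f g.
  by move=> cf cg x Ux; apply: continuousM; [exact: cf|exact: cg].
move=> Cf Cg; have [[df Df] [dg Dg]] := (Cf, Cg); split=> [x Ux|v].
  by apply: differentiableM; [exact: df|exact: dg].
have := Ck_funD (IH _ _ (Ck_funW Cf) (Dg v)) (IH _ _ (Ck_funW Cg) (Df v)).
apply: eq_Ck_fun => x Ux.
by rewrite deriveM //; apply: diff_derivable; [exact: df|exact: dg].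
Qed.

Lemma Ck_fun_sum k (I : finType) (Q : pred I) (F : I -> V -> R^o) :
  (forall i, Q i -> Ck_fun k U (F i)) ->
  Ck_fun k U (fun x => \sum_(i | Q i) F i x).
Proof.
move=> CF; have -> : (fun x => \sum_(i | Q i) F i x) = \sum_(i | Q i) F i.
  by apply/funext => x; rewrite fct_sumE.
elim/big_rec : _ => [|i f Qi Cf]; first exact: Ck_fun_cst.
by apply: Ck_funD => //; exact: CF.
Qed.

(** The derivative of 1/f is - f' / f^2, a product of functions that the induction
    hypothesis covers. *)
Lemma Ck_funV k (f : V -> R^o) :
  (forall x, U x -> f x != 0) -> Ck_fun k U f ->
  Ck_fun k U (fun x => (f x)^-1).
Proof.
move=> f0; elim: k => [|k IH].
  by move=> cf x Ux; apply: continuousV; [exact: f0|exact: cf].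
move=> Cf; have [df Df] := Cf; split=> [x Ux|v].
  by apply: differentiableV; [exact: df|exact: f0].
have CV := IH (Ck_funW Cf).
have := Ck_funM (Ck_fun_cst k (-1)) (Ck_funM (Df v) (Ck_funM CV CV)).
apply: eq_Ck_fun => x Ux.
rewrite deriveV ?f0 //; last by apply: diff_derivable; exact: df.
by rewrite !fctE /= mulN1r scaleNr -exprVn expr2 mulrC.
Qed.

Lemma Ck_fun_coord k (i : 'I_n) : Ck_fun k U (fun x => x 0 i).
Proof.
case: k => [|k]; first by move=> x _; exact: coord_continuous.
split=> [x _|v]; first exact: differentiable_coord.
apply: eq_Ck_fun (Ck_fun_cst k (v 0 i)) => x _.
have := derive_mx (@derivable_id R V x v); rewrite derive_id => vE.
by rewrite /cst [in LHS]vE mxE.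
Qed.

Lemma fun_row_sum_delta m (F : V -> 'rV[R]_m) :
  F = \sum_(j < m) (fun x => F x 0 j *: delta_mx 0 j).
Proof. by apply/funext => x; rewrite fct_sumE; exact: row_sum_delta. Qed.

(** Componentwise smoothness suffices because F is a finite sum of its components
    times fixed vectors; this reduces vector fields to the scalar calculus. *)
Lemma Ck_on_coord k m (F : V -> 'rV[R]_m) :
  Ck_on k U F <-> forall j, Ck_fun k U (fun x => F x 0 j).
Proof.
elim: k F => [|k IH] F /=.
  split=> [cF j x Ux|cF x Ux].
    apply: (@continuous_comp _ _ _ F (fun y : 'rV[R]_m => y 0 j : R^o)).
      exact: cF.
    exact: coord_continuous.
  rewrite (fun_row_sum_delta F); elim/big_rec : _ => [|j f _ cf].
    exact: cst_continuous.
  apply: continuousD; last exact: cf.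
  by apply: (@continuousZl _ _ _ (fun x => F x 0 j)); exact: cF.
have dcoord x j v : differentiable F x ->
    'D_v F x 0 j = 'D_v (fun y => F y 0 j : R^o) x.
  by move=> dF; rewrite derive_mx ?mxE //; exact: diff_derivable.
split=> [[dF DF] j|CF]; [split=> [x Ux|v]|].
- apply: (@differentiable_comp _ _ _ _ F (fun y : 'rV[R]_m => y 0 j : R^o)).
    exact: dF.
  exact: differentiable_coord.
- apply: eq_Ck_fun ((IH _).1 (DF v) j) => x Ux.
  by rewrite dcoord //; exact: dF.
- have dF x : U x -> differentiable F x.
    move=> Ux; rewrite (fun_row_sum_delta F); apply: differentiable_sum => j.
    by apply: (@differentiableZl _ _ _ (fun x => F x 0 j)); apply: (CF j).1.
  split=> // v; apply/IH => j; apply: eq_Ck_fun ((CF j).2 v) => x Ux.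
  by rewrite dcoord //; exact: dF.
Qed.

End ScalarSmoothness.

(** * Endomorphisms of a subspace and involutions *)

Section Compression.
Context {K : fieldType} {vT : vectType K}.
Variables (T : {vspace vT}) (L : 'End(vT)).
Hypothesis LT : forall v, v \in T -> L v \in T.

Definition compression : 'End(subvs_of T) :=
  (linfun (vsproj T) \o L \o linfun (@vsval _ _ T))%VF.

Lemma compressionE u : vsval (compression u) = L (vsval u).
Proof. by rewrite !comp_lfunE !lfunE /= vsprojK // LT // subvsP. Qed.

Lemma mem_img_vsval (W : {vspace subvs_of T}) v :
  (v \in (linfun (@vsval _ _ T) @: W)%VS) = (v \in T) && (vsproj T v \in W).
Proof.
apply/idP/andP => [/memv_imgP[w Ww ->]|[Tv Wv]].
  by rewrite lfunE /= subvsP vsvalK.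
by apply/memv_imgP; exists (vsproj T v) => //; rewrite lfunE /= vsprojK.
Qed.

Lemma mem_img_compression_plus v :
  (v \in (linfun (@vsval _ _ T) @: lker (\1%VF - compression)%R)%VS) =
  (v \in T) && (L v == v).
Proof.
rewrite mem_img_vsval; apply: andb_id2l => Tv.
rewrite memv_ker add_lfunE opp_lfunE id_lfunE subr_eq0 eq_sym.
by rewrite -(inj_eq val_inj) /= compressionE vsprojK.
Qed.

Lemma mem_img_compression_minus v :
  (v \in (linfun (@vsval _ _ T) @: lker (\1%VF + compression)%R)%VS) =
  (v \in T) && (L v == - v).
Proof.
rewrite mem_img_vsval; apply: andb_id2l => Tv.
rewrite memv_ker add_lfunE id_lfunE addrC addr_eq0.
by rewrite -(inj_eq val_inj) /= compressionE vsprojK.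
Qed.

Lemma dim_img_vsval (W : {vspace subvs_of T}) :
  \dim (linfun (@vsval _ _ T) @: W) = \dim W.
Proof.
apply: limg_dim_eq; apply/eqP; rewrite -subv0; apply/subvP => w.
rewrite memv_cap memv_ker lfunE /= => /andP[_ /eqP w0].
by rewrite memv0; apply/eqP/val_inj; rewrite /= w0.
Qed.

End Compression.

(** Away from characteristic 2 the image of Id - P is the kernel of Id + P: the
    product of these maps is Id - P^2 = 0, and if P v = - v then v = (Id - P)(v/2).
    The rank theorem for Id - P then gives the sum of the dimensions. *)
Lemma dim_eigen_involution (K : fieldType) (vT : vectType K) (P : 'End(vT)) :
  (2 : K) != 0 -> (P \o P)%VF = \1%VF ->
  (\dim (lker (\1%VF - P)%R) + \dim (lker (\1%VF + P)%R))%N = dim vT.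
Proof.
move=> n2 PP; have PPv v : P (P v) = v.
  by rewrite -[RHS](@id_lfunE _ _ v) -PP comp_lfunE.
suff <- : limg (\1%VF - P)%R = lker (\1%VF + P)%R.
  by have := limg_ker_dim (\1%VF - P)%R fullv; rewrite capfv dimvf.
apply/vspaceP => v; apply/memv_imgP/idP => [[w _ ->]|].
  rewrite memv_ker !(add_lfunE, opp_lfunE, id_lfunE) linearB /= PPv.
  by rewrite -[X in _ + X]opprB subrr.
rewrite memv_ker add_lfunE id_lfunE addr_eq0 => /eqP vE.
exists (2^-1 *: v); first exact: memvf.
have Pv : P v = - v by rewrite [in RHS]vE opprK.
rewrite !(add_lfunE, opp_lfunE, id_lfunE) linearZ /= Pv scalerN opprK -scalerDl.
by rewrite -mulr2n -[X in X *: _]mulr_natr mulVf // scale1r.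
Qed.

(** * Involutivity of distributions defined by linear forms *)

Section Bracket.
Context {R : realType}.
Notation V := 'rV[R]_7.
Implicit Types (A : 'M[R]_7) (x y v w : V).

(** For fixed A this is the 1-form on R^7, with coefficients linear in x, whose
    value at x on a vector y is x A y^T. *)
Definition mxform A x y : R := (x *m A *m y^T) 0 0.

Lemma mxformBr A x : {morph mxform A x : y z / y - z}.
Proof. by move=> y z; rewrite /mxform linearB mulmxBr !mxE. Qed.

Lemma mxform_delta i j x y : mxform (delta_mx i j) x y = x 0 i * y 0 j.
Proof.
rewrite /mxform -(mul_delta_mx (0 : 'I_1)) mulmxA -mulmxA -colE -rowE.
by rewrite !mxE big_ord1 !mxE.
Qed.

Lemma is_derive_coord (c : R -> V) (t : R) v i :
  is_derive t 1 c v -> is_derive t 1 (fun s => c s 0 i : R^o) (v 0 i).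
Proof.
move=> [dc <-]; apply: DeriveDef; last by rewrite derive_mx ?mxE.
by have /derivable_mxP := dc; exact.
Qed.

Lemma is_derive_mxform A (c d : R -> V) (t : R) v w :
  is_derive t 1 c v -> is_derive t 1 d w ->
  is_derive t 1 (fun s => mxform A (c s) (d s) : R^o)
    (mxform A v (d t) + mxform A (c t) w).
Proof.
move=> dc dd.
have mxformE x y : mxform A x y = \sum_(j < 7) \sum_(i < 7) A i j * (x 0 i * y 0 j).
  rewrite /mxform mxE; apply: eq_bigr => j _; rewrite !mxE mulr_suml.
  by apply: eq_bigr => i _; ring.
have -> : (fun s => mxform A (c s) (d s) : R^o) =
    \sum_(j < 7) \sum_(i < 7)
      (A i j *: ((fun s => c s 0 i : R^o) * (fun s => d s 0 j : R^o))).
  apply/funext => s; rewrite mxformE fct_sumE; apply: eq_bigr => j _.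
  by rewrite fct_sumE.
rewrite !mxformE -big_split /=.
apply: is_derive_sum => j; rewrite -big_split /=.
apply: is_derive_sum => i.
have ci := is_derive_coord i dc; have dj := is_derive_coord j dd.
apply: is_derive_eq; rewrite -mulrDr [in RHS]addrC.
by congr (_ * (_ + _)); exact: mulrC.
Qed.

(** The function p |-> p A Y(p)^T vanishes on S33 near x, so its derivative along
    a curve in S33 with velocity v is 0; the product rule expands it. *)
Lemma derive_mxform_vanishing A (U : set V) (Y : V -> V) x v : open U ->
  S33 x -> U x -> differentiable Y x -> v \in TS33 x ->
  (forall p, S33 p -> U p -> mxform A p (Y p) = 0) ->
  mxform A v (Y x) + mxform A x ('D_v Y x) = 0.
Proof.
move=> oU Sx Ux dY /(TS33_velocity _ Sx)[c [Sc c0 dc]] AY0.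
have [dc1 vE] := dc.
have cd : differentiable c 0 by exact/derivable1_diffP.
have dYc : is_derive (0 : R) (1 : R) (Y \o c) ('D_v Y x).
  have dY0 : differentiable Y (c 0) by rewrite c0.
  apply: DeriveDef.
    by apply/derivable1_diffP; exact: differentiable_comp.
  rewrite deriveE; last exact: differentiable_comp.
  by rewrite diff_comp //= c0 -deriveE // -vE -deriveE.
have := is_derive_mxform A dc dYc; rewrite /= c0 => -[_ <-].
transitivity ('D_1 (cst (0 : R^o)) (0 : R)); last exact: derive_cst.
apply: near_eq_derive.
have Uc : \forall t \near (0 : R), U (c t).
  have : nbhs (c 0) U by rewrite c0; exact: open_nbhs_nbhs.
  exact: (differentiable_continuous cd).
near=> t; apply: AY0; near: t; [exact: Sc|exact: Uc].
Unshelve. all: by end_near. Qed.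

(** Cartan's formula for the exterior derivative, evaluated on two fields that are
    annihilated by the form along S33: the terms X(w(Y)) and Y(w(X)) vanish since
    X and Y are tangent to S33. *)
Lemma mxform_lie_bracket A (U : set V) (X Y : V -> V) x : open U ->
  S33 x -> U x -> differentiable X x -> differentiable Y x ->
  X x \in TS33 x -> Y x \in TS33 x ->
  (forall p, S33 p -> U p -> mxform A p (X p) = 0) ->
  (forall p, S33 p -> U p -> mxform A p (Y p) = 0) ->
  mxform A x (lie_bracket X Y x) = mxform A (Y x) (X x) - mxform A (X x) (Y x).
Proof.
move=> oU Sx Ux dX dY TX TY AX AY.
have h1 := derive_mxform_vanishing oU Sx Ux dY TX AY.
have h2 := derive_mxform_vanishing oU Sx Ux dX TY AX.
rewrite /lie_bracket mxformBr; lra.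
Qed.

(** Tangency to S33 is itself the vanishing of the 1-form x G dx^T, with G the Gram
    matrix of the quadratic form; it is closed, G being symmetric. *)
Definition gram33 : 'M[R]_7 := diag_mx (\row_i (if (i < 3)%N then 1 else -1)).

Lemma mxform_gram33 x y : mxform gram33 x y = bform33 x y.
Proof.
rewrite /mxform /gram33 mul_mx_diag mxE /bform33.
rewrite (bigID (fun i : 'I_7 => (i < 3)%N)) /=; congr (_ + _).
  by apply: eq_bigr => i i3; rewrite !mxE i3 mulr1.
rewrite -[RHS]sumrN; apply: eq_big => i; first by rewrite -leqNgt.
by move=> /negPf i3; rewrite !mxE i3 mulrN1 mulNr.
Qed.

(** Frobenius' criterion: by [mxform_lie_bracket] the value of a defining form on
    the bracket is minus its exterior derivative on the two fields, and this
    vanishes on D by the symmetry assumption. *)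
Lemma involutive_of_forms (D : V -> {vspace V}) (F : set 'M[R]_7) :
  (forall x v, S33 x -> v \in D x <->
     v \in TS33 x /\ forall A, F A -> mxform A x v = 0) ->
  (forall x v w, S33 x -> v \in D x -> w \in D x ->
     forall A, F A -> mxform A v w = mxform A w v) ->
  involutive_dist S33 D.
Proof.
move=> DE Dsym U X Y oU CX CY DX DY x Sx Ux.
have [dX _] := CX 1; have [dY _] := CY 1.
have tX p : S33 p -> U p -> X p \in TS33 p.
  by move=> Sp Up; have /(DE _ _ Sp)[] := DX p Sp Up.
have tY p : S33 p -> U p -> Y p \in TS33 p.
  by move=> Sp Up; have /(DE _ _ Sp)[] := DY p Sp Up.
have bracketE A := @mxform_lie_bracket A U X Y x oU Sx Ux (dX _ Ux) (dY _ Ux)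
  (tX _ Sx Ux) (tY _ Sx Ux).
apply/DE => //; split=> [|A FA].
  rewrite mem_TS33 -mxform_gram33 bracketE => [|p Sp Up|p Sp Up].
  - rewrite !mxform_gram33 /bform33 subr_eq0; apply/eqP.
    by congr (_ - _); apply: eq_bigr => i _; rewrite mulrC.
  - by apply/eqP; rewrite mxform_gram33 -mem_TS33 tX.
  - by apply/eqP; rewrite mxform_gram33 -mem_TS33 tY.
rewrite bracketE => [|p Sp Up|p Sp Up].
- by rewrite (Dsym x (Y x) (X x) Sx) ?subrr //; [exact: DY|exact: DX].
- by have /(DE _ _ Sp)[_] := DX p Sp Up; exact.
- by have /(DE _ _ Sp)[_] := DY p Sp Up; exact.
Qed.

End Bracket.

(** * The product structure on R^3 x S^3 *)

Section Product.
Context {R : realType}.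
Notation V := 'rV[R]_7.
Implicit Types (x y v w : V) (i j : 'I_7).

Definition hdot x y : R := \sum_(i < 7 | (i < 3)%N) x 0 i * y 0 i.
Definition vdot x y : R := \sum_(i < 7 | (3 <= i)%N) x 0 i * y 0 i.

Lemma hdot_linear x : linear (hdot x).
Proof.
move=> a v w; rewrite /hdot scaler_sumr -big_split /=.
by apply: eq_bigr => i _; rewrite !mxE mulrDr mulrCA.
Qed.

Lemma S33_vdot x : S33 x -> vdot x x = 1 + hdot x x.
Proof.
rewrite /S33 /= => Sx.
have : hdot x x - vdot x x = -1.
  by rewrite -Sx; congr (_ - _); apply: eq_bigr => i _; rewrite expr2.
lra.
Qed.

Lemma hdot_ge0 x : 0 <= hdot x x.
Proof. by apply: sumr_ge0 => i _; rewrite -expr2 sqr_ge0. Qed.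

Lemma hdot1_neq0 x : 1 + hdot x x != 0.
Proof. by apply: lt0r_neq0; have := hdot_ge0 x; lra. Qed.

Lemma mem_TS33_dot x v : (v \in TS33 x) = (hdot x v == vdot x v).
Proof. by rewrite mem_TS33 -[RHS]subr_eq0. Qed.

(** For v = (a, b) at x = (u, y), the coefficient c such that (a, c y) is tangent to
    S33, by [slope_vdot]. *)
Definition slope x v : R := hdot x v / (1 + hdot x x).

(** The involution (a, b) |-> (a, 2 c y - b), that is, the reflection that fixes
    (a, c y) and changes the sign of (0, b - c y). *)
Definition refl33 x v : V :=
  \row_i (if (i < 3)%N then v 0 i else 2 * slope x v * x 0 i - v 0 i).

Lemma refl33_linear x : linear (refl33 x).
Proof.
move=> a v w; apply/rowP => i; rewrite !mxE /slope hdot_linear.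
by case: ifP => // _; rewrite /GRing.scale /=; ring.
Qed.

HB.instance Definition _ x := GRing.isLinear.Build R V V _ (refl33 x)
  (refl33_linear x).

Lemma hdot_refl33 x y v : hdot y (refl33 x v) = hdot y v.
Proof. by apply: eq_bigr => i i3; rewrite mxE i3. Qed.

Lemma vdot_refl33 x y v :
  vdot y (refl33 x v) = 2 * slope x v * vdot y x - vdot y v.
Proof.
rewrite /vdot mulr_sumr -sumrB; apply: eq_bigr => i i3.
by rewrite mxE ltnNge i3 /=; ring.
Qed.

Lemma slope_vdot x v : S33 x -> slope x v * vdot x x = hdot x v.
Proof. by move=> Sx; rewrite S33_vdot // divfK // hdot1_neq0. Qed.

Lemma refl33_TS33 x v : S33 x -> v \in TS33 x -> refl33 x v \in TS33 x.
Proof.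
move=> Sx; rewrite !mem_TS33_dot hdot_refl33 vdot_refl33 => /eqP e.
by rewrite -mulrA slope_vdot // -e; apply/eqP; ring.
Qed.

Lemma refl33K x : involutive (refl33 x).
Proof.
move=> v; apply/rowP => i; rewrite !mxE /slope hdot_refl33.
by case: ifP => i3; rewrite ?i3 //; ring.
Qed.

Lemma refl33_fixedP x v : refl33 x v = v <->
  forall i, (3 <= i)%N -> v 0 i = slope x v * x 0 i.
Proof.
split=> [e i i3|h].
  by have /rowP/(_ i) := e; rewrite mxE ltnNge i3 /=; lra.
apply/rowP => i; rewrite mxE; case: ltnP => // /h e.
by rewrite [in RHS]e [X in _ - X]e; ring.
Qed.

Lemma refl33_antifixedP x v : refl33 x v = - v <->
  forall i, (i < 3)%N -> v 0 i = 0.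
Proof.
split=> [e i i3|h].
  by have /rowP/(_ i) := e; rewrite !mxE i3; lra.
have s0 : slope x v = 0.
  by rewrite /slope /hdot big1 ?mul0r // => i /h ->; rewrite mulr0.
apply/rowP => i; rewrite !mxE s0; case: ltnP => [/h ->|_].
  by rewrite oppr0.
by rewrite mulr0 mul0r add0r.
Qed.

Definition P33 : endo_field (@TS33 R) :=
  fun x => compression (TS33 x) (linfun (refl33 x)).

Lemma linfun_refl33_TS33 x : S33 x ->
  forall v, v \in TS33 x -> linfun (refl33 x) v \in TS33 x.
Proof. by move=> Sx v Tv; rewrite lfunE refl33_TS33. Qed.

Lemma mem_eigen_plus x v : S33 x ->
  v \in eigen_plus P33 x <-> v \in TS33 x /\ refl33 x v = v.
Proof.
move=> Sx; rewrite mem_img_compression_plus; last exact: linfun_refl33_TS33.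
by rewrite lfunE /=; split=> [/andP[? /eqP]|[? ->]]; rewrite ?eqxx ?andbT.
Qed.

Lemma mem_eigen_minus x v : S33 x ->
  v \in eigen_minus P33 x <-> v \in TS33 x /\ refl33 x v = - v.
Proof.
move=> Sx; rewrite mem_img_compression_minus; last exact: linfun_refl33_TS33.
by rewrite lfunE /=; split=> [/andP[? /eqP]|[? ->]]; rewrite ?eqxx ?andbT.
Qed.

Lemma P33_involutive x : S33 x -> (P33 x \o P33 x)%VF = \1%VF.
Proof.
move=> Sx; apply/lfunP => u; apply/val_inj; rewrite /= comp_lfunE id_lfunE.
have E := compressionE (linfun_refl33_TS33 Sx).
by rewrite !E !lfunE /= refl33K.
Qed.

(** The forms y_i dy_j - y_j dy_i; they say that the last four components of a
    vector are proportional to y. *)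
Definition radial_forms : set 'M[R]_7 :=
  [set A | exists2 ij : 'I_7 * 'I_7, (3 <= ij.1)%N && (3 <= ij.2)%N &
     A = delta_mx ij.1 ij.2 - delta_mx ij.2 ij.1].

(** The forms y_j du_i; as y is nonzero on S33, their common kernel is that of
    the du_i, and the factor y_j makes the coefficients linear. *)
Definition vertical_forms : set 'M[R]_7 :=
  [set A | exists2 ij : 'I_7 * 'I_7, (3 <= ij.1)%N && (ij.2 < 3)%N &
     A = delta_mx ij.1 ij.2].

Lemma mxform_radial i j v w :
  mxform (delta_mx i j - delta_mx j i) v w = v 0 i * w 0 j - v 0 j * w 0 i.
Proof. by rewrite -!mxform_delta /mxform mulmxBr mulmxBl !mxE. Qed.

(** The exterior derivative of y_i dy_j - y_j dy_i is 2 dy_i /\ dy_j, which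
    vanishes on two vectors whose last four components are proportional to y. *)
Lemma involutive_eigen_plus : involutive_dist S33 (eigen_plus P33).
Proof.
apply: (@involutive_of_forms _ _ radial_forms) => [x v Sx|x v w Sx].
  rewrite mem_eigen_plus //; split=> -[Tv].
    move=> /refl33_fixedP h; split=> // _ [[i j] /= /andP[i3 j3] ->].
    by rewrite mxform_radial h // [v 0 i]h //; ring.
  move=> h; split=> //; apply/refl33_fixedP => j j3.
  (* Contracting x_i v_j = x_j v_i with x_i gives |y|^2 v_j = <y, b> x_j, and
     tangency replaces <y, b> by <u, a>. *)
  have e i : (3 <= i)%N -> x 0 i * v 0 j = x 0 j * v 0 i.
    move=> i3; apply/eqP; rewrite -subr_eq0 -mxform_radial h //.
    by exists (i, j); rewrite //= i3.
  have xx0 : vdot x x != 0 by rewrite S33_vdot // hdot1_neq0.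
  apply: (mulfI xx0); rewrite mulrCA mulrA slope_vdot //.
  have -> : hdot x v = vdot x v by apply/eqP; rewrite -mem_TS33_dot.
  rewrite /vdot !mulr_suml; apply: eq_bigr => i i3.
  by rewrite -mulrA e //; ring.
move=> /(mem_eigen_plus _ Sx)[_ /refl33_fixedP hv].
move=> /(mem_eigen_plus _ Sx)[_ /refl33_fixedP hw].
move=> _ [[i j] /= /andP[i3 j3] ->]; rewrite !mxform_radial.
by rewrite !(hv _ i3, hv _ j3, hw _ i3, hw _ j3); ring.
Qed.

(** The exterior derivative of y_j du_i is dy_j /\ du_i, and du_i vanishes on
    T^-. *)
Lemma involutive_eigen_minus : involutive_dist S33 (eigen_minus P33).
Proof.
apply: (@involutive_of_forms _ _ vertical_forms) => [x v Sx|x v w Sx].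
  rewrite mem_eigen_minus //; split=> -[Tv].
    move=> /refl33_antifixedP h; split=> // _ [[j i] /= /andP[j3 i3] ->].
    by rewrite mxform_delta h // mulr0.
  move=> h; split=> //; apply/refl33_antifixedP => i i3.
  have xx0 : vdot x x != 0 by rewrite S33_vdot // hdot1_neq0.
  (* Sum x_j (x_j v_i) = 0 over j to get |y|^2 v_i = 0. *)
  apply: (mulfI xx0); rewrite mulr0 /vdot mulr_suml big1 // => j j3.
  rewrite -mulrA -mxform_delta h ?mulr0 //.
  by exists (j, i); rewrite //= j3.
move=> /(mem_eigen_minus _ Sx)[_ /refl33_antifixedP hv].
move=> /(mem_eigen_minus _ Sx)[_ /refl33_antifixedP hw].
move=> _ [[j i] /= /andP[j3 i3] ->]; rewrite !mxform_delta.
by rewrite [v 0 i]hv // [w 0 i]hw // !mulr0.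
Qed.

Definition lift3 (a : 'rV[R]_3) : V :=
  \row_i (if (i < 3)%N then a 0 (inord i) else 0).

Definition graph_plus x (a : 'rV[R]_3) : V :=
  \row_i (if (i < 3)%N then a 0 (inord i) else slope x (lift3 a) * x 0 i).

Lemma graph_plus_linear x : linear (graph_plus x).
Proof.
have lift_linear : linear lift3.
  move=> k a b; apply/rowP => i; rewrite !mxE.
  by case: ifP => // _; rewrite mulr0 addr0.
move=> k a b; apply/rowP => i; rewrite !mxE lift_linear /slope hdot_linear.
by case: ifP => // _; rewrite /GRing.scale /=; ring.
Qed.

HB.instance Definition _ x := GRing.isLinear.Build R 'rV[R]_3 V _ (graph_plus x)
  (graph_plus_linear x).

(** T^+ projects isomorphically onto R^3 since a determines (a, c y). *)
Lemma dim_eigen_plus x : S33 x -> \dim (eigen_plus P33 x) = 3.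
Proof.
move=> Sx; have w3 (i : 'I_3) : (i < 7)%N by exact: leq_trans (ltn_ord i) _.
have hdotE y (v w : V) : (forall i, (i < 3)%N -> v 0 i = w 0 i) ->
    hdot y v = hdot y w.
  by move=> vw; apply: eq_bigr => i /vw ->.
have -> : eigen_plus P33 x = limg (linfun (graph_plus x)).
  apply/vspaceP => v; apply/idP/memv_imgP => [|[a _ ->]].
    move=> /(mem_eigen_plus _ Sx)[_ /refl33_fixedP h].
    exists (\row_i v 0 (Ordinal (w3 i))); first exact: memvf.
    rewrite lfunE; apply/rowP => i; rewrite !mxE.
    have vE (k : 'I_7) : (k < 3)%N -> v 0 (Ordinal (w3 (inord k))) = v 0 k.
      by move=> k3; congr (v 0 _); apply/val_inj; rewrite /= inordK.
    case: ltnP => [i3|i3]; first by rewrite vE.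
    rewrite h //; congr (_ / _ * _); apply: hdotE => j j3.
    by rewrite !mxE j3 vE.
  apply/(mem_eigen_plus _ Sx); rewrite lfunE /=.
  have hE : hdot x (graph_plus x a) = hdot x (lift3 a).
    by apply: hdotE => i i3; rewrite !mxE i3.
  split; last first.
    apply/refl33_fixedP => i i3; rewrite mxE ltnNge i3 /=.
    by rewrite /slope hE.
  rewrite mem_TS33_dot hE -[X in X == _]slope_vdot // mulr_sumr.
  by apply/eqP/eq_bigr => i i3; rewrite mxE ltnNge i3 /=; ring.
rewrite limg_dim_eq; first by rewrite dimvf.
apply/eqP; rewrite -subv0; apply/subvP => a.
rewrite memv_cap memv_ker lfunE => /andP[_ /eqP/rowP a0].
rewrite memv0; apply/eqP/rowP => i.
by have := a0 (Ordinal (w3 i)); rewrite !mxE /= ltn_ord inord_val.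
Qed.

(** T^- is a complement of T^+ in the tangent space, which has dimension 6. *)
Lemma dim_eigen_minus x : S33 x -> \dim (eigen_minus P33 x) = 3.
Proof.
move=> Sx; have := dim_eigen_plus Sx.
have n2 : (2 : R) != 0 by rewrite pnatr_eq0.
have := dim_eigen_involution n2 (P33_involutive Sx).
rewrite /eigen_plus /eigen_minus !dim_img_vsval.
have -> : dim (subvs_of (TS33 x)) = 6 by rewrite /dim /= dim_TS33.
by move=> e p; move: e; rewrite p => -[].
Qed.

(** A local smooth extension g of X gives the extension x |-> refl33 x (g x) of
    P X, whose components are built from those of g and the coordinates by ring
    operations and division by 1 + |u|^2. *)
Lemma smooth_P33 : smooth_endo_field S33 P33.
Proof.
move=> U X oU [sX TX].
have PX x : S33 x -> U x -> endo_apply P33 X x = refl33 x (X x).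
  move=> Sx Ux; rewrite /endo_apply compressionE; last exact: linfun_refl33_TS33.
  by rewrite lfunE vsprojK // TX.
split=> [p [Sp Up]|x Sx Ux]; last by rewrite PX // refl33_TS33 // TX.
have [W [g [oW Wp Cg Xg]]] := sX p (conj Sp Up).
exists W, (fun x => refl33 x (g x)); split=> // [k|x [Sx Ux] Wx]; last first.
  by rewrite PX // Xg.
apply/Ck_on_coord => // i; have /(Ck_on_coord oW) gi := Cg k.
have Chdot (h : V -> V) : (forall j, Ck_fun k W (fun x => h x 0 j)) ->
    Ck_fun k W (fun x => hdot x (h x)).
  move=> Ch; apply: Ck_fun_sum => // j _.
  by apply: Ck_funM => //; exact: Ck_fun_coord.
have Cid j : Ck_fun k W (fun x : V => x 0 j) by exact: Ck_fun_coord.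
case: (ltnP i 3) => i3.
  by apply: eq_Ck_fun (gi i) => // x Wx; rewrite mxE i3.
have Cslope : Ck_fun k W (fun x => slope x (g x)).
  apply: Ck_funM; [by []|exact: Chdot|].
  apply: Ck_funV => // [x _|]; first exact: hdot1_neq0.
  by apply: Ck_funD => //; [exact: Ck_fun_cst|exact: Chdot].
(* The component 2 c x_i - g_i, written as 2 c x_i + (-1) g_i. *)
have := Ck_funM oW (Ck_funM oW (Ck_fun_cst oW k 2) Cslope) (Cid i).
move=> /(Ck_funD oW)/(_ (Ck_funM oW (Ck_fun_cst oW k (-1)) (gi i))).
apply: eq_Ck_fun => // x Wx.
by rewrite mxE ltnNge i3 /= !fctE mulN1r.
Qed.

End Product.

Theorem mainTheorem8 (R : realType) :
  exists P : endo_field (@TS33 R), para_complex (@S33 R) P.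
Proof.
exists P33; split; last first.
  by split; [exact: involutive_eigen_plus|exact: involutive_eigen_minus].
split; [exact: smooth_P33|exact: P33_involutive|].
by move=> x Sx; rewrite dim_eigen_plus // dim_eigen_minus.
Qed.
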